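(* Let $n\ge 2$ and $0\le d\le n$, and let $\Omega\subset\mathbb{R}^n$, $\Omega\neq\mathbb{R}^n$, be a domain whose boundary $\partial\Omega$ is Ahlfors-regular with dimension $d$. Suppose moreover that $H^d(\partial\Omega)<+\infty$. Let $K\geq 1$ and let $u:\Omega\to[0,+\infty)$ be a $K$-quasi-nearly subharmonic function. Let $\varphi:[0,+\infty)\to[0,+\infty)$ be an admissible function with constants $r_0$ and $C_0$. Let $\alpha>0$ be arbitrary, and let $\gamma\in\mathbb{R}$ be such that $$\int_{\Omega}\delta(x)^{\gamma}u(x)\,dm(x)<+\infty.$$ Then there is a constant $C=C(n,\Omega,d,\varphi,\alpha,\gamma,K)>0$, depending only on the listed data (so depending on $u$ only through $K$), such that $$\int_{\partial\Omega}\ \sup_{x\in\Gamma_{\varphi}(\zeta,\alpha)}\left\{\delta(x)^{n+\gamma}\,[\varphi^{-1}(\delta(x))]^{-d}\,u(x)\right\}\,dH^d(\zeta)\ \le\ C\int_{\Omega}\delta(x)^{\gamma}u(x)\,dm(x).$$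
   Context: Notation: $m$ is Lebesgue measure in $\mathbb{R}^n$; $B^n(x,r)$ is the Euclidean ball with center $x$ and radius $r$; $\nu_n=m(B^n(0,1))$; $H^d$ is the $d$-dimensional Hausdorff (outer) measure in $\mathbb{R}^n$; $\delta(x)$ is the distance from $x\in\Omega$ to $\partial\Omega$. Ahlfors-regular: a set $E\subset\mathbb{R}^n$ is Ahlfors-regular with dimension $d$ ($0\le d\le n$) if it is closed and there is a constant $C_4>0$ such that $H^d(E\cap B^n(x,r))\le C_4r^d$ for all $x\in E$ and $r>0$, and $C_4^{-1}r^d\le H^d(E\cap B^n(x,r))$ for all $x\in E$ and $0<r\le\operatorname{diam}E$ (all $r>0$ if $E$ is unbounded). Quasi-nearly subharmonic: for a domain $D\subset \mathbb{R}^n$ and $K\ge1$, a Lebesgue measurable function $u:D\to[-\infty,+\infty)$ is $K$-quasi-nearly subharmonic if $u^+$ is locally integrable on $D$ and, for every closed ball $\overline{B^n(x,r)}\subset D$ and every $M\ge0$, $$u_M(x)\le\frac{K}{\nu_n r^n}\int_{B^n(x,r)}u_M(y)\,dm(y),\qquad u_M:=\sup\{u,-M\}+M.$$ Admissible function: $\varphi:[0,+\infty)\to[0,+\infty)$ is admissible with constants $C_0\ge1$ and $r_0>0$ if it is strictly increasing, surjective, and $\varphi(2t)\le C_0\varphi(t)$ and $\varphi^{-1}(2s)\le C_0\varphi^{-1}(s)$ for all $0\le s,t\le r_0$. The constants $C_0,r_0$ are fixed together with $\varphi$, and dependence of a constant on $\varphi$ includes dependence on $C_0,r_0$. Approach regions: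 for $\zeta\in\partial\Omega$ and $\alpha>0$, $$\Gamma_\varphi(\zeta,\alpha)=\{x\in\Omega:\varphi(|x-\zeta|)<\alpha\,\delta(x)\}.$$ Suprema are taken in $[0,+\infty]$, the supremum over the empty set being $0$. *)

(* Defs.v *)
From HB Require Import structures.
From mathcomp Require Import all_boot all_order all_algebra.
From mathcomp Require Import all_classical all_reals all_analysis.
From mathcomp Require Import measurable_realfun.

Set Implicit Arguments.
Unset Strict Implicit.
Unset Printing Implicit Defensive.

Import Order.TTheory GRing.Theory Num.Theory.
Import numFieldNormedType.Exports.

Local Open Scope classical_set_scope.
Local Open Scope ring_scope.

(* Supremum in [0, +oo]; the supremum of the empty set is 0, whereas
   [ereal_sup set0] is -oo. *)
Definition nnsup {R : realType} (A : set (\bar R)) : \bar R :=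
  ereal_sup (0%E |` A).

Section cover_outer.
Context {R : realType} {T I : Type}.
Variables (S : I -> set T) (g : I -> \bar R).
Local Open Scope ereal_scope.

(* The infimum of the total cost of the countable covers of [X] by sets [S i].
   [None] stands for an absent member, so that finite and empty families are
   countable families. *)
Definition is_cover (X : set T) : set (nat -> option I) :=
  [set c | X `<=` \bigcup_k oapp S set0 (c k)].

Definition cover_outer (X : set T) : \bar R :=
  ereal_inf [set \sum_(k <oo) oapp g 0 (c k) | c in is_cover X].

Hypothesis g0 : forall i, 0 <= g i.

Let og0 o : 0 <= oapp g 0 o. Proof. by case: o => /=. Qed.

Lemma cover_outer_ge0 X : 0 <= cover_outer X.
Proof. by apply: le_ereal_inf_tmp => _ [c _ <-]; exact: nneseries_ge0. Qed.

Lemma cover_outer0 : cover_outer set0 = 0.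
Proof.
apply/eqP; rewrite eq_le cover_outer_ge0 andbT.
by apply: ereal_inf_lbound; exists (fun=> None) => //; rewrite eseries0.
Qed.

Lemma le_cover_outer : {homo cover_outer : A B / A `<=` B >-> A <= B}.
Proof.
move=> A B AB; apply/ereal_inf_le_tmp => x [c cB <-{x}].
by exists c => //; exact: subset_trans AB cB.
Qed.

Lemma cover_outer_sigma_subadditive : sigma_subadditive cover_outer.
Proof.
move=> A; have [[i ioo]|] := pselect (exists i, cover_outer (A i) = +oo).
  rewrite (eseries_pinfty _ _ ioo) ?leey// => n _.
  by rewrite -ltNye (lt_le_trans _ (cover_outer_ge0 _)).
rewrite -forallNE => Aoo.
apply/lee_addgt0Pr => _/posnumP[e].
rewrite (le_trans _ (epsilon_trick _ _ _))//; last first.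
  by move=> n; exact: cover_outer_ge0.
pose P n (c : nat -> option I) := is_cover (A n) c /\
  \sum_(k <oo) oapp g 0 (c k) <=
    cover_outer (A n) + (e%:num / (2 ^ n.+1)%:R)%:E.
have [G PG] : {G : nat -> nat -> option I & forall n, P n (G n)}.
  apply: (@choice _ _ P) => n.
  have en1 : (0 < e%:num / (2 ^ n.+1)%:R)%R by [].
  have fA : cover_outer (A n) \is a fin_num.
    by rewrite ge0_fin_numE ?cover_outer_ge0// ltey; exact/eqP/Aoo.
  have [_ [c cA <-] cle] := lb_ereal_inf_adherent en1 fA.
  by exists c; split => //; exact/ltW.
pose h (p : nat * nat) := oapp g 0 (G p.1 p.2).
have h0 x : 0 <= h x by exact: og0.
apply: (@le_trans _ _ (\esum_(i in setT) h i)).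
  apply: ereal_inf_lbound => /=.
  have /card_esym/ppcard_eqP[f] := card_nat2.
  exists (fun k => G (f k).1 (f k).2).
    move=> t [n _ /(PG n).1[j _ Gt]].
    by exists (f^-1%FUN (n, j)) => //=; rewrite invK ?inE.
  rewrite -(esum_pred_image h _ xpredT) ?[fun=> _]set_true//.
  by rewrite image_eq.
rewrite (_ : esum _ _ = \sum_(i <oo) \sum_(j <oo) oapp g 0 (G i j)); last first.
  pose J : nat -> set (nat * nat) := fun i => [set (i, j) | j in setT].
  rewrite (_ : setT = \bigcup_k J k); last first.
    by rewrite predeqE => -[a b]; split => // _; exists a => //; exists b.
  rewrite esum_bigcupT /=; last 2 first.
    - apply/trivIsetP => i j _ _ ij.
      rewrite predeqE => -[n m] /=; split => //= -[] [_] _ [<-{n} _].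
      by move=> [m' _] [] /esym/eqP; rewrite (negbTE ij).
    - by move=> /= [n m]; exact: h0.
  rewrite -(image_id [set: nat]) -fun_true esum_pred_image//; last first.
    by move=> n _; exact: esum_ge0.
  apply: eq_eseriesr => /= j _.
  rewrite -(esum_pred_image h (pair j) predT)//=; last first.
    by move=> ? ? _ _; exact: (@can_inj _ _ _ snd).
  by congr esum; rewrite predeqE => -[a b]; split; move=> [i _ <-]; exists i.
apply: lee_nneseries => [i _ _|i _]; last exact: (PG i).2.
exact: nneseries_ge0.
Qed.

End cover_outer.

Section euclidean.
Context {R : realType} {n : nat}.
Implicit Types (x y : 'rV[R]_n) (A : set 'rV[R]_n).

(* The library norm of ['rV[R]_n] is the sup norm; it has the same topology. *)
Definition enorm x : R := Num.sqrt (\sum_(i < n) x ord0 i ^+ 2).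

Definition eball x (r : R) : set 'rV[R]_n := [set y | enorm (y - x) < r].

Definition eclosed_ball x (r : R) : set 'rV[R]_n :=
  [set y | enorm (y - x) <= r].

Definition ediam A : \bar R :=
  nnsup [set (enorm (p.1 - p.2))%:E | p in A `*` A].

Definition boundary A : set 'rV[R]_n := closure A `\` interior A.

Definition bdist A x : R := inf [set enorm (x - y) | y in boundary A].

Definition is_domain A := [/\ A !=set0, open A & connected A].

End euclidean.

Section lebesgue.
Context {R : realType} {n : nat}.

Definition box (ab : 'rV[R]_n * 'rV[R]_n) : set 'rV[R]_n :=
  [set x | forall i, ab.1 ord0 i < x ord0 i <= ab.2 ord0 i].

Definition box_vol (ab : 'rV[R]_n * 'rV[R]_n) : \bar R :=
  (\prod_(i < n) Num.max 0 (ab.2 ord0 i - ab.1 ord0 i))%:E.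

Definition lebesgue_outer : set 'rV[R]_n -> \bar R := cover_outer box box_vol.

Let box_vol_ge0 ab : (0 <= box_vol ab)%E.
Proof. by rewrite lee_fin prodr_ge0// => i _; rewrite le_max lexx. Qed.

HB.instance Definition _ := isOuterMeasure.Build R 'rV[R]_n lebesgue_outer
  (@cover_outer0 _ _ _ box _ box_vol_ge0)
  (@cover_outer_ge0 _ _ _ box _ box_vol_ge0)
  (@le_cover_outer _ _ _ box box_vol)
  (@cover_outer_sigma_subadditive _ _ _ box _ box_vol_ge0).

End lebesgue.
Arguments lebesgue_outer : clear implicits.

(* ['rV[R]_n] with the sigma-algebra of Lebesgue measurable sets *)
Notation rVleb R n := (caratheodory_type (lebesgue_outer R n)).

Section leb.
Variables (R : realType) (n : nat).

Definition leb : set (rVleb R n) -> \bar R := lebesgue_outer R n.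

HB.instance Definition _ := isMeasure.Build _ _ _ leb
  (@caratheodory_measure0 _ _ (lebesgue_outer R n))
  (@caratheodory_measure_ge0 _ _ (lebesgue_outer R n))
  (@caratheodory_measure_sigma_additive _ _ (lebesgue_outer R n)).

End leb.
Arguments leb : clear implicits.

Section hausdorff.
Context {R : realType} (n : nat) (d : R).
Local Open Scope ereal_scope.

Definition hausdorff_premeasure (e : R) : set 'rV[R]_n -> \bar R :=
  cover_outer (fun A : {A : set 'rV[R]_n | ediam A <= e%:E} => sval A)
              (fun A => ediam (sval A) `^ d).

(* No normalising constant is applied. For d = 0 this is the counting measure,
   as 0 `^ 0 = 1 and the empty set is covered by the empty family. *)
Definition hausdorff_outer (X : set 'rV[R]_n) : \bar R :=
  ereal_sup [set hausdorff_premeasure e X | e in [set e : R | (0 < e)%R]].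

Let gauge_ge0 (e : R) (A : {A : set 'rV[R]_n | ediam A <= e%:E}) :
  0 <= ediam (sval A) `^ d.
Proof. exact: poweR_ge0. Qed.

Let hausdorff_outer0 : hausdorff_outer set0 = 0.
Proof.
apply/eqP; rewrite eq_le; apply/andP; split.
  apply: ge_ereal_sup => _ [e _ <-].
  by rewrite /hausdorff_premeasure cover_outer0.
apply: ereal_sup_ubound; exists 1%R => //=.
by rewrite /hausdorff_premeasure cover_outer0.
Qed.

Let hausdorff_outer_ge0 X : 0 <= hausdorff_outer X.
Proof.
apply: (@le_trans _ _ (hausdorff_premeasure 1 X)).
  exact: cover_outer_ge0.
by apply: ereal_sup_ubound; exists 1%R => //=.
Qed.

Let le_hausdorff_outer : {homo hausdorff_outer : A B / A `<=` B >-> A <= B}.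
Proof.
move=> A B AB; apply: ge_ereal_sup => _ [e e0 <-].
apply: (@le_trans _ _ (hausdorff_premeasure e B)); first exact: le_cover_outer.
by apply: ereal_sup_ubound; exists e.
Qed.

Let hausdorff_outer_sigma_subadditive : sigma_subadditive hausdorff_outer.
Proof.
move=> F; apply: ge_ereal_sup => _ [e e0 <-].
apply: (le_trans (cover_outer_sigma_subadditive _ (@gauge_ge0 e) F)).
apply: lee_nneseries => [i _ _|i _]; first exact: cover_outer_ge0.
by apply: ereal_sup_ubound; exists e.
Qed.

HB.instance Definition _ := isOuterMeasure.Build R 'rV[R]_n hausdorff_outer
  hausdorff_outer0 hausdorff_outer_ge0 le_hausdorff_outer
  hausdorff_outer_sigma_subadditive.

End hausdorff.

Section hausdorff_measure.
Context {R : realType} (n : nat) (d : R).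
Let H : {outer_measure set 'rV[R]_n -> \bar R} := @hausdorff_outer R n d.

Definition hausdorff :
  set (caratheodory_type (@hausdorff_outer R n d)) -> \bar R :=
  @hausdorff_outer R n d.

HB.instance Definition _ := isMeasure.Build _ _ _ hausdorff
  (@caratheodory_measure0 _ _ H)
  (@caratheodory_measure_ge0 _ _ H)
  (@caratheodory_measure_sigma_additive _ _ H).

End hausdorff_measure.
Arguments hausdorff {R} n d.

Section notions.
Context {R : realType} {n : nat}.
Implicit Types (D E : set 'rV[R]_n) (x zeta : 'rV[R]_n).

(* The upper end of the range of [r] in the lower bound is +oo when [E] is
   unbounded. *)
Definition ahlfors_regular (d : R) E :=
  closed E /\ exists C4 : R, [/\ 0 < C4,
    forall x r, E x -> 0 < r ->
      (hausdorff_outer d (E `&` eball x r) <= (C4 * r `^ d)%:E)%E &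
    forall x r, E x -> 0 < r -> (r%:E <= ediam E)%E ->
      ((C4^-1 * r `^ d)%:E <= hausdorff_outer d (E `&` eball x r))%E].

Definition ball_vol : R := fine (leb R n (eball 0 1)).

Definition trunc_below (M : R) (u : 'rV[R]_n -> \bar R) x : \bar R :=
  (maxe (u x) (- M)%:E + M%:E)%E.

(* Only the values of [u] on [D] matter. *)
Definition quasi_nearly_subharmonic (K : R) D (u : 'rV[R]_n -> \bar R) :=
  [/\ forall x, D x -> (u x < +oo)%E,
      measurable_fun (D : set (rVleb R n)) (u : rVleb R n -> \bar R),
      forall A, compact A -> A `<=` D ->
        (leb R n).-integrable (A : set (rVleb R n)) (u^\+)%E &
      forall x r, 0 < r -> eclosed_ball x r `<=` D ->
      forall M, 0 <= M ->
        (trunc_below M u x <= (K / (ball_vol * r ^+ n))%:E *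
           \int[leb R n]_(y in eball x r) trunc_below M u y)%E].

End notions.
Arguments ball_vol : clear implicits.

Section admissible.
Context {R : realType}.
Implicit Types (phi : R -> R).

(* A function [0, +oo) -> [0, +oo) is given by its values on [0, +oo). *)
Definition inv_phi phi : R -> R := 'pinv_(fun=> 0) `[0, +oo[%classic phi.

Definition admissible phi (C0 r0 : R) :=
  [/\ 1 <= C0 /\ 0 < r0,
      set_fun `[0, +oo[%classic `[0, +oo[%classic phi /\
        set_surj `[0, +oo[%classic `[0, +oo[%classic phi,
      {in `[0, +oo[ &, {homo phi : s t / s < t}},
      forall t, 0 <= t <= r0 -> phi (2 * t) <= C0 * phi t &
      forall s, 0 <= s <= r0 -> inv_phi phi (2 * s) <= C0 * inv_phi phi s].

Definition approach_region n (Omega : set 'rV[R]_n) phi zeta (alpha : R) :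
    set 'rV[R]_n :=
  [set x | Omega x /\ phi (enorm (x - zeta)) < alpha * bdist Omega x].

End admissible.

(* Main.v *)
Require Import Defs.
From HB Require Import structures.
From mathcomp Require Import all_boot all_order all_algebra.
From mathcomp Require Import all_classical all_reals all_analysis.
From mathcomp Require Import measurable_realfun.
From mathcomp Require Import lra ring zify.

(** The boundary function is a supremum over approach regions, and it is bounded
    by transferring each value of [u] to a piece of the domain on which the
    weighted function is integrated.

    Cut [Omega] into countably many disjoint measurable pieces, each of diameter
    at most a multiple of its distance to the boundary. If [x] lies in the
    domain, the ball of radius a quarter of the distance [delta x] meets a
    bounded number of pieces, so the mean value inequality gives a piece [j]
    meeting this ball with
    [delta x `^ (n + gamma) * u x] at most a constant times the integral of
    [delta `^ gamma * u] over the piece ([weighted_le_piece]).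

    Write [psi] for the inverse of [phi], [t j] for the scale of the piece [j],
    and call a boundary point a contact point of [j] when its approach region
    contains such an [x]. The supremum at [zeta] is then at most the supremum of
    [a j] over the pieces [j] of which [zeta] is a contact point, where [a j] is
    a constant times [psi (t j) `^ (- d)] times the integral over the piece.
    Conversely all contact points of [j] lie in a ball of radius comparable to
    [psi (t j)], so that the Hausdorff measure of this contact set is at most a
    constant times [psi (t j) `^ d] ([hausdorff_contact]); Ahlfors regularity
    and doubling give this at small scales, the finiteness of the measure of the
    boundary at large ones. In the sum over [j] of [a j] times the measure of
    the contact set the powers of [psi] cancel, and what remains is a constant
    times the sum of the integrals over the disjoint pieces, that is, the
    integral over [Omega].

    That the integral of the supremum is at most this sum is
    [integral_le_weighted_cover]. It is a statement about outer measures and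
    arbitrary sets, and it takes the place of an exchange of integrals, for which
    the maximal function and the contact sets would have to be measurable. *)

Set Implicit Arguments.
Unset Strict Implicit.
Unset Printing Implicit Defensive.

Import Order.TTheory GRing.Theory Num.Theory.
Import numFieldNormedType.Exports.

Local Open Scope classical_set_scope.
Local Open Scope ring_scope.

(** * The Euclidean norm and functions that are 1-Lipschitz for it *)

Section euclidean_norm.
Context {R : realType} {n : nat}.
Implicit Types x y z : 'rV[R]_n.

Lemma enorm_ge0 x : 0 <= enorm x. Proof. exact: sqrtr_ge0. Qed.

Lemma enorm_sqr x : enorm x ^+ 2 = \sum_(i < n) x ord0 i ^+ 2.
Proof. by rewrite sqr_sqrtr// sumr_ge0// => i _; exact: sqr_ge0. Qed.

Lemma enormN x : enorm (- x) = enorm x.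
Proof. by congr Num.sqrt; apply: eq_bigr => i _; rewrite mxE sqrrN. Qed.

Lemma enormC x y : enorm (x - y) = enorm (y - x).
Proof. by rewrite -enormN opprB. Qed.

Lemma coord_le_enorm x i : `|x ord0 i| <= enorm x.
Proof.
rewrite -sqrtr_sqr ler_sqrt; last by rewrite sumr_ge0// => j _; exact: sqr_ge0.
by rewrite (bigD1 i)//= lerDl sumr_ge0// => j _; exact: sqr_ge0.
Qed.

Lemma dot_le_enorm x y : \sum_(i < n) x ord0 i * y ord0 i <= enorm x * enorm y.
Proof.
set a := enorm x; set b := enorm y.
have a0 : 0 <= a by exact: enorm_ge0.
have b0 : 0 <= b by exact: enorm_ge0.
have [ab|] := ltP 0 (a * b).
  have : 0 <= \sum_(i < n) (b * x ord0 i - a * y ord0 i) ^+ 2.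
    by rewrite sumr_ge0// => i _; exact: sqr_ge0.
  have -> : \sum_(i < n) (b * x ord0 i - a * y ord0 i) ^+ 2 =
      b ^+ 2 * a ^+ 2 + a ^+ 2 * b ^+ 2 -
        2 * (a * b) * \sum_(i < n) x ord0 i * y ord0 i.
    rewrite [X in _ * X + _ - _]enorm_sqr [X in _ + _ * X - _]enorm_sqr.
    rewrite !mulr_sumr -big_split -sumrB; apply: eq_bigr => i _ /=; ring.
  move=> h; rewrite -(ler_pM2l ab); nra.
move=> ab0; have /eqP : a * b = 0 by apply/le_anti; rewrite ab0 mulr_ge0.
rewrite mulf_eq0 => ab; rewrite big1 ?mulr_ge0// => i _.
case/orP: ab => /eqP z0.
  have := coord_le_enorm x i; rewrite -/a z0 normr_le0 => /eqP ->.
  by rewrite mul0r.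
have := coord_le_enorm y i; rewrite -/b z0 normr_le0 => /eqP ->.
by rewrite mulr0.
Qed.

Lemma ler_enormD x y : enorm (x + y) <= enorm x + enorm y.
Proof.
rewrite -(@ler_pXn2r _ 2)// ?nnegrE ?addr_ge0 ?enorm_ge0//.
rewrite sqrrD !enorm_sqr.
have -> : \sum_(i < n) (x + y) ord0 i ^+ 2 = \sum_(i < n) x ord0 i ^+ 2 +
    (\sum_(i < n) x ord0 i * y ord0 i) *+ 2 + \sum_(i < n) y ord0 i ^+ 2.
  rewrite -sumrMnl -!big_split /=; apply: eq_bigr => i _.
  by rewrite mxE sqrrD.
by rewrite lerD2r lerD2l lerMn2r dot_le_enorm.
Qed.

Lemma ler_enorm_trans z x y : enorm (x - y) <= enorm (x - z) + enorm (z - y).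
Proof. by apply: le_trans (ler_enormD _ _); rewrite addrA subrK. Qed.

(** The factor [n], rather than its square root, costs nothing: the constants of
    the maximal inequality depend on [n] anyway. *)
Lemma enorm_le_coord x b : 0 <= b -> (forall i, `|x ord0 i| <= b) ->
  enorm x <= n%:R * b.
Proof.
move=> b0 xb; rewrite -(@ler_pXn2r _ 2)// ?nnegrE ?mulr_ge0 ?enorm_ge0//.
rewrite enorm_sqr; apply: (@le_trans _ _ (\sum_(i < n) b ^+ 2)).
  apply: ler_sum => i _; rewrite -real_normK ?num_real//.
  by rewrite ler_pXn2r ?nnegrE.
rewrite sumr_const card_ord exprMn -[leLHS]mulr_natl ler_wpM2r ?sqr_ge0//.
by rewrite -natrX ler_nat; case: (n) => // m; rewrite leq_pmulr.
Qed.

Lemma ball_enorm_lt x y e : 0 < e -> ball x (e / n.+1%:R) y ->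
  enorm (x - y) < e.
Proof.
move=> e0 [_ xy]; have n0 : 0 < n.+1%:R :> R by rewrite ltr0n.
have /le_lt_trans : enorm (x - y) <= n%:R * (e / n.+1%:R).
  apply: enorm_le_coord => [|i]; first by rewrite divr_ge0// ltW.
  by rewrite !mxE ltW//; exact: xy.
by apply; rewrite mulrCA gtr_pMr// ltr_pdivrMr// mul1r ltr_nat.
Qed.

(** Coordinates, distances to a point and the distance to the boundary all have
    this property, which makes their Lebesgue measurability a single lemma. *)
Definition enorm_lipschitz (f : 'rV[R]_n -> R) :=
  forall x y, `|f x - f y| <= enorm (x - y).

Lemma enorm_lipschitzN f : enorm_lipschitz f -> enorm_lipschitz (\- f).
Proof. by move=> lf x y; rewrite /= opprK addrC distrC. Qed.

Lemma enorm_lipschitz_open_gt f a : enorm_lipschitz f -> open [set x | a < f x].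
Proof.
move=> lf; rewrite openE => x /= afx; apply/nbhs_ballP.
exists ((f x - a) / n.+1%:R) => /=; first by rewrite divr_gt0 ?subr_gt0.
move=> y /ball_enorm_lt; rewrite subr_gt0 => /(_ afx) xy.
have := le_lt_trans (le_trans (ler_norm _) (lf x y)) xy.
by rewrite ltrD2l ltrN2.
Qed.

Lemma enorm_lipschitz_enormB z : enorm_lipschitz (fun x => enorm (x - z)).
Proof.
move=> x y; rewrite ler_norml lerBrDr addrC lerBlDl.
have := ler_enorm_trans x y z; have := ler_enorm_trans y x z.
rewrite (enormC y x) => h1 h2; lra.
Qed.

Lemma eballP z r : eball z r = [set x | - r < (\- (fun x => enorm (x - z))) x].
Proof. by apply/seteqP; split => x /=; rewrite ltrN2. Qed.

Lemma open_eball z r : open (eball z r).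
Proof.
rewrite eballP; apply: enorm_lipschitz_open_gt.
exact/enorm_lipschitzN/enorm_lipschitz_enormB.
Qed.

End euclidean_norm.

(** * The distance to the boundary *)

Section boundary_distance.
Context {R : realType} {n : nat} (Omega : set 'rV[R]_n).
Hypothesis oO : open Omega.
Implicit Types x y z : 'rV[R]_n.

Lemma boundary_open : boundary Omega = closure Omega `\` Omega.
Proof. by rewrite /boundary (interior_id _).1. Qed.

(** A connected set that misses the boundary of an open set meets it in a
    relatively open and closed subset; here the connected set is a segment.
    This gives both the nonemptiness of the boundary and the inclusion in the
    domain of the balls of radius smaller than the distance to the boundary. *)
Lemma segment_meets_boundary x y : Omega x -> ~ Omega y ->
  exists2 z, boundary Omega z & enorm (x - z) <= enorm (x - y).
Proof.
move=> Ox Oy.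
pose g (t : R) : 'rV[R]_n := x + t *: (y - x).
have cg : continuous g.
  move=> t; apply: cvgD; first exact: cvg_cst.
  by apply: cvgZl; exact: cvg_id.
pose C := g @` `[0, 1].
have cC : connected C.
  apply: connected_continuous_connected; first exact: segment_connected.
  exact: continuous_subspaceT.
have [CO|] := pselect (exists2 z, C z & boundary Omega z).
  case: CO => z [t t01 <-] bz; exists (g t) => //.
  move: t01; rewrite /= in_itv/= => /andP[t0 t1].
  have -> : x - g t = t *: (x - y).
    by rewrite /g opprD addrA subrr add0r -scalerN opprB.
  rewrite /enorm -[leRHS]mul1r; under eq_bigr do rewrite mxE exprMn.
  rewrite -mulr_sumr sqrtrM ?sqr_ge0// sqrtr_sqr ger0_norm//.
  by rewrite ler_wpM2r// sqrtr_ge0.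
move=> nC; exfalso; apply: Oy.
have Cx : C x by exists 0; rewrite /= ?in_itv/= ?lexx ?ler01// /g scale0r addr0.
have Cy : C y.
  by exists 1; rewrite /= ?in_itv/= ?lexx ?ler01// /g scale1r addrC subrK.
have CE : C `&` Omega = C.
  apply: cC; first by exists x.
    by exists Omega.
  exists (closure Omega); first exact: closed_closure.
  apply/seteqP; split=> z [Cz Oz]; split=> //; first exact: subset_closure.
  have [//|nOz] := pselect (Omega z).
  by exfalso; apply: nC; exists z => //; rewrite boundary_open.
by move: Cy; rewrite -CE => -[].
Qed.

Hypothesis bO : boundary Omega !=set0.

Let bdset x := [set enorm (x - y) | y in boundary Omega].

Lemma bdist_le x z : boundary Omega z -> bdist Omega x <= enorm (x - z).
Proof.
move=> bz; apply: ge_inf; last by exists z.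
by exists 0 => _ [y _ <-]; exact: enorm_ge0.
Qed.

Lemma bdist_ge x r : (forall z, boundary Omega z -> r <= enorm (x - z)) ->
  r <= bdist Omega x.
Proof.
move=> rb; apply: lb_le_inf; last by move=> _ [z bz <-]; exact: rb.
by case: bO => z bz; exists (enorm (x - z)); exists z.
Qed.

Lemma enorm_lipschitz_bdist : enorm_lipschitz (bdist Omega).
Proof.
have h x y : bdist Omega x <= bdist Omega y + enorm (x - y).
  rewrite -lerBlDr; apply: bdist_ge => z bz.
  rewrite lerBlDr addrC; apply: (le_trans (bdist_le x bz)).
  exact: ler_enorm_trans.
move=> x y; rewrite ler_norml; have := h x y; have := h y x.
rewrite (enormC y x) => h1 h2; lra.
Qed.

Lemma bdist_gt0 x : Omega x -> 0 < bdist Omega x.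
Proof.
move=> Ox; move: oO; rewrite openE => /(_ x Ox) /nbhs_ballP[e /= e0 xe].
apply: (lt_le_trans e0); apply: bdist_ge => z.
rewrite boundary_open => -[_ nOz].
rewrite leNgt; apply/negP => xz; apply/nOz/xe; split => // i j.
rewrite (ord1 i) /ball/=; apply: le_lt_trans xz.
by have := coord_le_enorm (x - z) j; rewrite !mxE.
Qed.

Lemma eclosed_ball_sub x r : Omega x -> r < bdist Omega x ->
  eclosed_ball x r `<=` Omega.
Proof.
move=> Ox rb y; rewrite /eclosed_ball/= enormC => xy.
have [//|/(segment_meets_boundary Ox)[z bz xz]] := pselect (Omega y).
have := le_lt_trans (le_trans (le_trans (bdist_le x bz) xz) xy) rb.
by rewrite ltxx.
Qed.

End boundary_distance.

(** * Open sets are Lebesgue measurable *)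

Section lebesgue_measurability.
Context {R : realType} {n : nat}.

Lemma box_vol_cut (a b : 'rV[R]_n) i t :
  (box_vol (a, \row_j (if j == i then Num.min (b ord0 j) t else b ord0 j)) +
   box_vol (\row_j (if j == i then Num.max (a ord0 j) t else a ord0 j), b))%E =
  box_vol (a, b).
Proof.
rewrite /box_vol -EFinD; congr EFin => /=.
rewrite (bigD1 i)//= [X in _ + X](bigD1 i)//= [RHS](bigD1 i)//= !mxE eqxx.
rewrite [X in _ * X + _](eq_bigr
  (fun j => Num.max 0 (b ord0 j - a ord0 j))); last first.
  by move=> j /negbTE ji; rewrite !mxE ji.
rewrite [X in _ + _ * X](eq_bigr
  (fun j => Num.max 0 (b ord0 j - a ord0 j))); last first.
  by move=> j /negbTE ji; rewrite !mxE ji.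
rewrite -mulrDl; congr (_ * _).
rewrite /Num.min /Num.max; do ![case: ifPn => //]; rewrite -?leNgt => *; lra.
Qed.

(** A coordinate hyperplane cuts every box of a cover into two boxes, one on
    each side, whose volumes add up; so it cuts the outer measure additively. *)
Lemma measurable_halfspace i (t : R) :
  measurable ([set x : 'rV[R]_n | x ord0 i <= t] : set (rVleb R n)).
Proof.
apply: le_caratheodory_measurable => X.
have bv0 (o : option ('rV[R]_n * 'rV[R]_n)) : (0 <= oapp box_vol 0 o)%E.
  by case: o => //= ab; rewrite lee_fin prodr_ge0// => j _; rewrite le_max lexx.
apply: le_ereal_inf_tmp => _ [c cX <-].
pose lo (ab : 'rV[R]_n * 'rV[R]_n) :=
  (ab.1, \row_j (if j == i then Num.min (ab.2 ord0 j) t else ab.2 ord0 j)).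
pose hi (ab : 'rV[R]_n * 'rV[R]_n) :=
  (\row_j (if j == i then Num.max (ab.1 ord0 j) t else ab.1 ord0 j), ab.2).
have -> : (\sum_(k <oo) oapp box_vol 0 (c k) =
    \sum_(k <oo) oapp box_vol 0 (omap lo (c k)) +
    \sum_(k <oo) oapp box_vol 0 (omap hi (c k)))%E.
  rewrite -nneseriesD; [|by move=> *; exact: bv0..].
  apply: eq_eseriesr => k _; case: (c k) => [[a b]|] /=; last by rewrite adde0.
  by rewrite box_vol_cut.
apply: leeD; apply: ereal_inf_lbound.
  exists (fun k => omap lo (c k)) => // x [Xx /= xt].
  have [k _] := cX _ Xx; case ck : (c k) => [ab|]//= abx.
  exists k => //=; rewrite ck /= => j /=; rewrite mxE.
  by have := abx j; case: eqP => // ->; rewrite le_min xt andbT.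
exists (fun k => omap hi (c k)) => // x [Xx /= /negP]; rewrite -ltNge => xt.
have [k _] := cX _ Xx; case ck : (c k) => [ab|]//= abx.
exists k => //=; rewrite ck /= => j /=; rewrite mxE.
by have := abx j; case: eqP => // ->; rewrite gt_max xt andbT.
Qed.

Lemma measurable_box ab : measurable (box ab : set (rVleb R n)).
Proof.
rewrite (_ : box ab = \bigcap_(i in [set: 'I_n])
    ((~` [set x | x ord0 i <= ab.1 ord0 i]) `&`
     [set x | x ord0 i <= ab.2 ord0 i])).
  apply: fin_bigcap_measurable => // i _; apply: measurableI.
    by apply: measurableC; exact: measurable_halfspace.
  exact: measurable_halfspace.
apply/seteqP; split => x xab i.
  move=> _; have /andP[h1 h2] := xab i; split=> //=.
  by apply/negP; rewrite -ltNge.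
by have [/= /negP] := xab i I; rewrite -ltNge => -> ->.
Qed.

(** An open set is the union of the countably many boxes with rational vertices
    that it contains. *)
Lemma measurable_open (U : set 'rV[R]_n) :
  open U -> measurable (U : set (rVleb R n)).
Proof.
move=> oU.
pose q (p : 'rV[rat]_n * 'rV[rat]_n) : 'rV[R]_n * 'rV[R]_n :=
  (map_mx ratr p.1, map_mx ratr p.2).
pose F p : set (rVleb R n) :=
  if `[< box (q p) `<=` U >] then box (q p) else set0.
rewrite (_ : U = \bigcup_p F p); last first.
  apply/seteqP; split; last first.
    by move=> x [p _]; rewrite /F; case: asboolP => // + ? ; exact.
  move=> x Ux; move: oU; rewrite openE => /(_ _ Ux) /nbhs_ballP[e /= e0 xeU].
  have lt1 i : exists r : rat, x ord0 i - e < ratr r < x ord0 i.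
    have [|r] := @rat_in_itvoo R (x ord0 i - e) (x ord0 i).
      by rewrite ltrBlDr ltrDl.
    by rewrite in_itv /= => ?; exists r.
  have lt2 i : exists r : rat, x ord0 i < ratr r < x ord0 i + e.
    have [|r] := @rat_in_itvoo R (x ord0 i) (x ord0 i + e).
      by rewrite ltrDl.
    by rewrite in_itv /= => ?; exists r.
  have [a ha] := choice lt1; have [b hb] := choice lt2.
  exists (\row_i a i, \row_i b i) => //; rewrite /F asboolT.
    move=> i; rewrite !mxE.
    by have /andP[_ ->] := ha i; have /andP[/ltW -> _] := hb i.
  move=> y yab; apply: xeU; split => // i j; rewrite (ord1 i) /ball /=.
  have := yab j; rewrite !mxE => /andP[h1 h2].
  have /andP[h3 _] := ha j; have /andP[_ h4] := hb j.
  rewrite ltr_norml; lra.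
apply: countable_bigcupT_measurable; first exact: countableP.
move=> p; rewrite /F; case: asboolP => // _; exact: measurable_box.
Qed.

End lebesgue_measurability.
(** * Integrals dominated by weighted covers *)

Section weighted_cover.
Local Open Scope ereal_scope.
Context (R : realType).
Import HBNNSimple.

Lemma caratheodory_fibers_le (T : Type) (V : eqType)
    (mu : {outer_measure set T -> \bar R}) (h : T -> V) (X : set T)
    (s : seq V) :
  (forall v, mu.-caratheodory (h @^-1` [set v])) -> uniq s ->
  \sum_(v <- s) mu (X `&` h @^-1` [set v]) <= mu X.
Proof.
move=> mh; elim: s X => [|v s ih] X /=.
  by rewrite big_nil outer_measure_ge0.
move=> /andP[vs us]; rewrite big_cons (mh v X) leeD2l//.
apply: le_trans (ih _ us); rewrite big_seq [leRHS]big_seq.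
apply: lee_sum => w ws; apply: le_outer_measure => x [Xx /= hx].
split=> //; split=> //= hv; move: vs.
by rewrite -hv hx ws.
Qed.

(** Neither [D], nor [f], nor the sets [E j] are assumed measurable, so the
    integral of [f] is a lower integral and cannot be bounded term by term by
    the integrals of the functions equal to [a j] on [E j]: lower integrals are
    not subadditive. Instead, let [h <= f] be simple and [l < 1]. At a point [x]
    with [h x = v > 0], some [j] has [x] in [E j] and [l * v <= a j]; hence
    [l * v * mu (h = v)] is at most the sum over [j] of
    [a j * mu (E j `&` (h = v))]. Summing over the values [v] recovers
    [mu (E j)], because the level sets of [h] are measurable and so split the
    arbitrary set [E j] additively. *)
Lemma integral_le_weighted_cover d (T : measurableType d)
    (m : {measure set T -> \bar R}) (mu : {outer_measure set T -> \bar R})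
    (D : set T) (f : T -> \bar R) (E : nat -> set T) (a : nat -> \bar R) :
  (forall A, measurable A -> m A = mu A) ->
  (forall A, measurable A -> mu.-caratheodory A) ->
  (forall x, D x -> 0 <= f x) -> (forall j, 0 <= a j) ->
  (forall x (v : R), D x -> (0 < v)%R -> v%:E < f x ->
    exists2 j, E j x & v%:E <= a j) ->
  \int[m]_(x in D) f x <= \sum_(j <oo) a j * mu (E j).
Proof.
move=> mE mC f0 a0 cov; rewrite ge0_integralE//.
apply: ge_ereal_sup => _ [h /= hf <-].
apply/lee_mul01Pr; first exact: sintegral_ge0.
move=> l /andP[l0 l1].
pose A v : set T := h @^-1` [set v].
have mA v : measurable (A v) by exact: measurable_sfunP.
rewrite sintegralE ge0_mule_fsumr; last first.
  move=> v; have [v0|v0] := leP 0%R v; first by rewrite mule_ge0.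
  rewrite (_ : h @^-1` [set v] = set0) ?measure0 ?mule0// -subset0 => x /= hx.
  by move: v0; rewrite -hx ltNge fun_ge0.
have le1 v : range h v -> l%:E * (v%:E * m (A v)) <=
    \sum_(j <oo) a j * mu (E j `&` A v).
  move=> [x0 _ hx0]; have : (0 <= v)%R by rewrite -hx0 fun_ge0.
  rewrite le_eqVlt.
  move=> /predU1P[<-|v0].
    by rewrite mul0e mule0 nneseries_ge0// => j _ _; rewrite mule_ge0.
  rewrite mE// muleA -EFinM.
  (* only the E j whose weight reaches l * v are needed to cover {h = v} *)
  pose F j := if (l * v)%:E <= a j then E j `&` A v else set0.
  have AF : A v `<=` \bigcup_j F j.
    move=> x hx; have := hf x; rewrite patchE hx.
    case: ifPn => [/set_mem Dx vf|_]; last by rewrite lee_fin leNgt v0.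
    have lv : (l * v)%:E < f x.
      by apply: lt_le_trans vf; rewrite lte_fin gtr_pMl.
    have [|j Ej aj] := cov x _ Dx _ lv; first by rewrite mulr_gt0.
    by exists j => //; rewrite /F aj.
  apply: (@le_trans _ _ ((l * v)%:E * \sum_(j <oo) mu (F j))).
    apply: lee_wpmul2l; first by rewrite lee_fin mulr_ge0// ltW.
    apply: (le_trans (le_outer_measure mu _ _ AF)).
    exact: outer_measure_sigma_subadditive.
  rewrite -nneseriesZl; last by move=> *; exact: outer_measure_ge0.
  apply: lee_nneseries => [j _ _|j _].
    by rewrite mule_ge0 ?lee_fin ?mulr_ge0// ltW.
  rewrite /F; case: ifPn => [la|_]; first exact: lee_wpmul2r.
  by rewrite outer_measure0 mule0 mule_ge0.
have finh : finite_set (range h) by exact: fimfunP.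
rewrite fsbig_finite//=; set s := finmap.enum_fset _.
have us : uniq s by exact: finmap.fset_uniq.
have {}le1 v : v \in s ->
    l%:E * (v%:E * m (A v)) <= \sum_(j <oo) a j * mu (E j `&` A v).
  by move=> vs; apply: le1; apply/set_mem; rewrite -(in_fset_set finh).
clearbody s; rewrite big_seq.
apply: (le_trans (lee_sum _ le1)); rewrite -big_seq.
rewrite -nneseries_sum; last by move=> *; rewrite mule_ge0.
apply: lee_nneseries => [j _ _|j _].
  by apply: sume_ge0 => v _; rewrite mule_ge0.
rewrite -ge0_sume_distrr//.
by apply: lee_wpmul2l => //; apply: caratheodory_fibers_le => // v; exact: mC.
Qed.

End weighted_cover.

(** * Comparable scales and the inverse of an admissible function *)

Section scalar_lemmas.
Context {R : realType}.

Lemma powR_comparable (g a b : R) :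
  0 < a -> 0 < b -> a <= 2 * b -> b <= 2 * a ->
  a `^ g <= 2 `^ `|g| * b `^ g.
Proof.
move=> a0 b0 ab ba.
rewrite /powR !gt_eqF// -expRD ler_expR.
have l1 : ln a <= ln 2 + ln b by rewrite -lnM ?posrE// ler_ln ?posrE// mulr_gt0.
have l2 : ln b <= ln 2 + ln a by rewrite -lnM ?posrE// ler_ln ?posrE// mulr_gt0.
have [g0|g0] := leP 0 g.
  by rewrite ger0_norm// -mulrDr ler_wpM2l.
rewrite ltr0_norm//; nra.
Qed.

(** This bounds the number of grid cells met by a ball: a real number that moves
    by at most one unit can only enter an adjacent unit interval. *)
Lemma floor_close (a b : R) : `|a - b| <= 1 ->
  exists e : 'I_3, Num.floor a = Num.floor b + e%:Z - 1.
Proof.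
rewrite ler_norml => /andP[h1 h2].
have /andP[fa1 fa2] := floor_itv a.
have /andP[fb1 fb2] := floor_itv b.
have l1 : Num.floor a <= Num.floor b + 1.
  by rewrite -ltzD1 -(ltr_int R) !rmorphD/= ; lra.
have l2 : Num.floor b <= Num.floor a + 1.
  by rewrite -ltzD1 -(ltr_int R) !rmorphD/= ; lra.
have : (absz (Num.floor a - Num.floor b + 1)%R < 3)%N by lia.
move=> h; exists (Ordinal h) => /=; lia.
Qed.

End scalar_lemmas.

Section inverse_gauge.
Context {R : realType} (phi : R -> R) (C0 r0 : R).
Hypothesis adm : admissible phi C0 r0.
Local Notation psi := (inv_phi phi).

Let mono (s t : R) : 0 <= s -> 0 <= t -> (phi s < phi t) = (s < t).
Proof.
case: adm => _ _ sm _ _ s0 t0; apply/idP/idP => [|st].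
  apply: contraTT; rewrite -!leNgt le_eqVlt => /predU1P[->//|ts].
  by apply/ltW/sm => //; rewrite in_itv/= ?s0 ?t0.
by apply: sm => //; rewrite in_itv/= ?s0 ?t0.
Qed.

Lemma inv_phi_ge0 (s : R) : 0 <= s -> 0 <= psi s.
Proof.
case: adm => _ [_ sur] _ _ _ s0.
have := @surjpinv_image_sub _ _ (fun=> 0) _ _ _ sur.
move=> /(_ (psi s)); rewrite /= in_itv/= andbT; apply.
by exists s => //=; rewrite in_itv/= s0.
Qed.

Lemma inv_phiK (s : R) : 0 <= s -> phi (psi s) = s.
Proof.
case: adm => _ [_ sur] _ _ _ s0; apply: (surjpK _ sur).
by apply/mem_set; rewrite /= in_itv/= s0.
Qed.

Lemma lt_inv_phi (s t : R) : 0 <= s -> 0 <= t -> (t < psi s) = (phi t < s).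
Proof. by move=> s0 t0; rewrite -{2}(inv_phiK s0) mono ?inv_phi_ge0. Qed.

Lemma le_inv_phi (s t : R) : 0 <= s -> s <= t -> psi s <= psi t.
Proof.
move=> s0 st; have t0 := le_trans s0 st.
by rewrite leNgt lt_inv_phi ?inv_phi_ge0// inv_phiK// -leNgt.
Qed.

Lemma inv_phi_gt0 (s : R) : 0 < s -> 0 < psi s.
Proof.
move=> s0; rewrite lt_inv_phi// ?ltW//.
have := inv_phiK (lexx 0); have := inv_phi_ge0 (lexx 0).
rewrite le_eqVlt => /predU1P[<- -> //|p0 p0E].
have : phi 0 < phi (psi 0) by rewrite mono// ltW.
by rewrite p0E => /lt_trans; apply.
Qed.

Lemma inv_phi_doubling m (s : R) : 0 <= s -> 2 ^+ m * s <= r0 ->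
  psi (2 ^+ m * s) <= C0 ^+ m * psi s.
Proof.
case: adm => [[C01 _] _ _ _ dbl] s0; elim: m => [|m ih].
  by rewrite !expr0 !mul1r.
rewrite !exprS -!mulrA => h.
have h0 : 0 <= 2 ^+ m * s by rewrite mulr_ge0// exprn_ge0.
have h1 : 2 ^+ m * s <= r0 by lra.
apply: le_trans (dbl _ _) _; first by rewrite h0.
by rewrite ler_wpM2l ?ih//; lra.
Qed.

End inverse_gauge.
(** * Whitney pieces of the domain *)

Section lipschitz_measurability.
Context {R : realType} {n : nat}.

Lemma measurable_enorm_lipschitz (f : 'rV[R]_n -> R) :
  enorm_lipschitz f -> measurable_fun setT (f : rVleb R n -> R).
Proof.
move=> lf mT; apply: (measurability _ (RGenOInfty.measurableE R)) => //.
move=> _ [_ [a ->] <-]; rewrite setTI; apply: measurable_open.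
rewrite (_ : _ @^-1` _ = [set x | a < f x]).
  exact: enorm_lipschitz_open_gt.
by apply/seteqP; split => x /=; rewrite in_itv/= andbT.
Qed.

Lemma enorm_lipschitz_coord i : enorm_lipschitz (fun x : 'rV[R]_n => x ord0 i).
Proof. by move=> x y; have := coord_le_enorm (x - y) i; rewrite !mxE. Qed.

Lemma measurable_lipschitz_co (f : 'rV[R]_n -> R) a b : enorm_lipschitz f ->
  measurable ([set x | a <= f x < b] : set (rVleb R n)).
Proof.
move=> /measurable_enorm_lipschitz mf.
have := mf measurableT _ (measurable_itv `[a, b[).
by rewrite setTI; congr measurable; apply/seteqP; split => x /=; rewrite in_itv.
Qed.

End lipschitz_measurability.

Section pigeonhole.
Local Open Scope ereal_scope.

(** An integral over a finite union is at most the number of members times the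
    largest of their integrals. Passing to a single member in this way, rather
    than keeping the union, is what later avoids any bounded-overlap count. *)
Lemma integral_cover_pigeonhole d (T : measurableType d) (R : realType)
    (m : {measure set T -> \bar R}) (I : finType) (i0 : I) (P : I -> set T)
    (B : set T) (f : T -> \bar R) :
  measurable B -> (forall i, measurable (P i)) -> measurable_fun B f ->
  (forall x, B x -> 0 <= f x) -> B `<=` \bigcup_i P i ->
  exists i, \int[m]_(x in B) f x <= #|I|%:R%:E * \int[m]_(x in B `&` P i) f x.
Proof.
move=> mB mP mf f0 BP.
pose F i := \int[m]_(x in B `&` P i) f x.
have [i _ imax] := @Order.TotalTheory.arg_maxP _ _ _ i0 xpredT F isT.
exists i.
have mfP j : measurable_fun B (f \_ (P j)).
  by apply/measurable_restrict => //; apply: measurable_funS mf => //;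
    exact: subIsetl.
have fP0 j x : B x -> 0 <= (f \_ (P j)) x.
  by move=> Bx; rewrite patchE; case: ifPn => // _; exact: f0.
apply: (@le_trans _ _ (\int[m]_(x in B) \sum_(j : I) (f \_ (P j)) x)).
  apply: ge0_le_integral => //.
  - by apply: emeasurable_sum => j; exact: mfP.
  - move=> x Bx; have [j _ Pj] := BP _ Bx.
    rewrite (bigD1 j)//= patchE mem_set// leeDl//.
    by apply: sume_ge0 => k _; exact: fP0.
rewrite ge0_integral_sum//.
apply: (@le_trans _ _ (\sum_(j : I) F i)).
  apply: lee_sum => j _; rewrite -integral_mkcondr; exact: imax.
by rewrite sumr_const mule_natl.
Qed.

End pigeonhole.

Section pieces.
Context {R : realType} {n : nat} (Omega : set 'rV[R]_n).
Hypotheses (oO : open Omega) (bO : boundary Omega !=set0).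
Local Notation delta := (bdist Omega).

Definition scale (k : int) : R := expR k%:~R.

(** The integer logarithm of the distance to the boundary, in base [expR 1]. *)
Definition level (y : 'rV[R]_n) : int := Num.floor (ln (delta y)).

(** The grid at level [k] has mesh [scale (k + 1)], which exceeds the distance
    to the boundary there. A ball of radius a quarter of that distance then moves
    every grid coordinate by less than one unit. *)
Definition cell (y : 'rV[R]_n) : int * {ffun 'I_n -> int} :=
  (level y, [ffun i => Num.floor (y ord0 i / scale (level y + 1))]).

(** The fibers of one function are disjoint and cover the domain by
    construction; they replace a Whitney decomposition into cubes. *)
Definition piece j : set 'rV[R]_n := Omega `&` cell @^-1` [set j].

Lemma scale_gt0 k : 0 < scale k. Proof. exact: expR_gt0. Qed.

Lemma scaleD j k : scale (j + k) = scale j * scale k.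
Proof. by rewrite /scale rmorphD/= expRD. Qed.

Lemma level_eq y k : Omega y ->
  (level y == k) = (scale k <= delta y < scale (k + 1)).
Proof.
move=> Oy; have d0 := bdist_gt0 oO bO Oy; rewrite /level floor_eq.
by rewrite -(ler_expR k%:~R) -(ltr_expR _ (k + 1)%:~R) lnK// posrE.
Qed.

Lemma level_itv y : Omega y -> scale (level y) <= delta y < scale (level y + 1).
Proof. by move=> Oy; rewrite -level_eq. Qed.

Lemma measurable_piece j : measurable (piece j : set (rVleb R n)).
Proof.
case: j => k q.
have -> : piece (k, q) =
    (Omega `&` [set y | scale k <= delta y < scale (k + 1)]) `&`
    \bigcap_(i in [set: 'I_n]) [set y : 'rV[R]_n |
      (q i)%:~R * scale (k + 1) <= y ord0 i < (q i + 1)%:~R * scale (k + 1)].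
  have s0 := scale_gt0 (k + 1).
  apply/seteqP; split => y.
    move=> [Oy [/eqP lk <-]]; split; first by split=> //=; rewrite -level_eq.
    move=> i _ /=; rewrite ffunE (eqP lk).
    by rewrite -ler_pdivlMr// -ltr_pdivrMr// floor_itv.
  move=> [[Oy /= yk] yq]; split => //=.
  move: yk; rewrite -level_eq// => /eqP yk.
  rewrite /cell yk; congr pair; apply/ffunP => i; rewrite ffunE.
  by apply: floor_def; rewrite ler_pdivlMr// ltr_pdivrMr//; exact: yq.
apply: measurableI.
  apply: measurableI; first exact: measurable_open.
  exact/measurable_lipschitz_co/enorm_lipschitz_bdist.
apply: fin_bigcap_measurable => // i _.
exact/measurable_lipschitz_co/enorm_lipschitz_coord.
Qed.

Lemma piece_diam j y y' : piece j y -> piece j y' ->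
  enorm (y - y') <= n%:R * scale (j.1 + 1).
Proof.
case: j => k q [_ [lk yq]] [_ [lk' yq']] /=.
have s0 := scale_gt0 (k + 1).
apply: enorm_le_coord; first exact: ltW.
move=> i; rewrite !mxE.
have := floor_itv (y ord0 i / scale (k + 1)).
have := floor_itv (y' ord0 i / scale (k + 1)).
have <- : q i = Num.floor (y ord0 i / scale (k + 1)) by rewrite -yq ffunE lk.
have <- : q i = Num.floor (y' ord0 i / scale (k + 1)) by rewrite -yq' ffunE lk'.
rewrite !ler_pdivlMr// !ltr_pdivrMr// rmorphD/= => /andP[h1 h2] /andP[h3 h4].
rewrite ler_norml; apply/andP; split; lra.
Qed.

Lemma bdist_ball x y : eball x (delta x / 4) y ->
  3 / 4 * delta x <= delta y <= 5 / 4 * delta x.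
Proof.
rewrite /eball/= => xy; have := enorm_lipschitz_bdist bO y x.
rewrite ler_norml => /andP[h1 h2].
apply/andP; split; lra.
Qed.

Lemma ball_subset_domain x : Omega x -> eball x (delta x / 4) `<=` Omega.
Proof.
move=> Ox y; rewrite /eball/= => xy; have d0 := bdist_gt0 oO bO Ox.
by apply: (eclosed_ball_sub oO (r := delta x / 4) Ox _ (ltW xy)); lra.
Qed.

(** The offsets in ['I_3] stand for -1, 0 and 1. The grid coordinates of [x] are
    read at the neighboring level, whose mesh differs from that of [x]. *)
Definition neighbor x (s : 'I_3 * {ffun 'I_n -> 'I_3}) :
    int * {ffun 'I_n -> int} :=
  let k := level x + s.1%:Z - 1 in
  (k, [ffun i => Num.floor (x ord0 i / scale (k + 1)) + (s.2 i)%:Z - 1]).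

Lemma ball_sub_pieces x : Omega x ->
  eball x (delta x / 4) `<=` \bigcup_s piece (neighbor x s).
Proof.
move=> Ox y xy; have Oy := ball_subset_domain Ox xy.
have dx := bdist_gt0 oO bO Ox; have dy := bdist_gt0 oO bO Oy.
have /andP[xy1 xy2] := bdist_ball xy.
(* the distances at x and y differ by a factor less than 2 <= expR 1 *)
have [e0 he0] : exists e : 'I_3, level y = level x + e%:Z - 1.
  apply: floor_close; rewrite -ln_div ?posrE// ler_norml.
  have h1 : delta y / delta x <= 1 + 1.
    by rewrite ler_pdivrMr//; lra.
  have h2 : delta x / delta y <= 1 + 1.
    by rewrite ler_pdivrMr//; lra.
  have e2 : 1 + 1 <= expR 1 :> R by exact: expR_ge1Dx.
  rewrite lerNl -lnV ?posrE ?divr_gt0// invf_div.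
  rewrite -!(ler_expR (ln _)) !lnK ?posrE ?divr_gt0//.
  by rewrite (le_trans h1 e2) (le_trans h2 e2).
have [e he] : exists e : 'I_n -> 'I_3, forall i,
    Num.floor (y ord0 i / scale (level y + 1)) =
    Num.floor (x ord0 i / scale (level y + 1)) + (e i)%:Z - 1.
  suff /choice[e ?] : forall i, exists e : 'I_3,
      Num.floor (y ord0 i / scale (level y + 1)) =
      Num.floor (x ord0 i / scale (level y + 1)) + e%:Z - 1 by exists e.
  move=> i; apply: floor_close.
  have s0 := scale_gt0 (level y + 1).
  rewrite -mulrBl normrM (gtr0_norm (_ : 0 < _^-1)) ?invr_gt0//.
  rewrite ler_pdivrMr// mul1r.
  have := coord_le_enorm (y - x) i; rewrite !mxE => /le_trans; apply.
  have /andP[_] := level_itv Oy; move: xy; rewrite /eball/=; lra.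
exists (e0, [ffun i => e i]) => //; split => //=.
rewrite /cell /neighbor/= -he0; congr pair; apply/ffunP => i.
by rewrite !ffunE he.
Qed.

End pieces.
(** * The mean value inequality on Whitney pieces *)

Section mean_value.
Local Open Scope ereal_scope.
Context {R : realType} {n : nat} (Omega : set 'rV[R]_n).
Hypotheses (oO : open Omega) (bO : boundary Omega !=set0).
Local Notation delta := (bdist Omega).
Variables (K gamma : R) (u : 'rV[R]_n -> R).
Hypotheses (K0 : (0 <= K)%R) (u0 : forall x, Omega x -> (0 <= u x)%R).
Hypothesis qu : quasi_nearly_subharmonic K Omega (fun x => (u x)%:E).

Definition weighted x : \bar R := (delta x `^ gamma * u x)%:E.

Lemma weighted_ge0 x : Omega x -> 0 <= weighted x.
Proof. by move=> Ox; rewrite lee_fin mulr_ge0 ?powR_ge0 ?u0. Qed.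

Lemma measurable_weighted :
  measurable_fun (Omega : set (rVleb R n)) (weighted : rVleb R n -> \bar R).
Proof.
have -> : weighted = (fun x => (delta x `^ gamma)%:E * (u x)%:E).
  by apply/funext => x; rewrite -EFinM.
apply: emeasurable_funM; last by case: qu.
apply/measurable_EFinP/measurable_funTS.
apply: (measurableT_comp (measurable_powR gamma)).
exact/measurable_enorm_lipschitz/enorm_lipschitz_bdist.
Qed.

(** The factor [4 ^+ n] comes from the radius [delta x / 4], the last one from
    replacing [delta x] by [delta y] for [y] in the ball. *)
Definition mean_value_constant : R :=
  (K / ball_vol R n * 4 ^+ n * 2 `^ `|gamma|)%R.

Lemma ball_vol_ge0 : (0 <= ball_vol R n)%R.
Proof. by rewrite fine_ge0. Qed.

Lemma mean_value_constant_ge0 : (0 <= mean_value_constant)%R.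
Proof. by rewrite !mulr_ge0 ?invr_ge0 ?ball_vol_ge0 ?exprn_ge0 ?powR_ge0. Qed.

(** The case [M = 0] of quasi-nearly subharmonicity in the ball of radius
    [delta x / 4], inside which the weight is comparable to its value at [x]. *)
Lemma weighted_mean_value x : Omega x ->
  (delta x `^ (n%:R + gamma) * u x)%:E <=
  mean_value_constant%:E *
    \int[leb R n]_(y in eball x (delta x / 4)) weighted y.
Proof.
move=> Ox; have d0 := bdist_gt0 oO bO Ox; set B := eball x (delta x / 4).
have BO : B `<=` Omega by exact: ball_subset_domain.
have mB : measurable (B : set (rVleb R n)) by exact/measurable_open/open_eball.
case: (qu) => _ mu _ /(_ x (delta x / 4)%R) mv.
have {mv} : (u x)%:E <= (K / (ball_vol R n * (delta x / 4) ^+ n))%:E *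
    \int[leb R n]_(y in B) (u y)%:E.
  have tr y : Omega y -> trunc_below 0 (fun x => (u x)%:E) y = (u y)%:E.
    move=> Oy; rewrite /trunc_below adde0 oppr0.
    by apply/max_idPl; rewrite lee_fin u0.
  have cB : eclosed_ball x (delta x / 4) `<=` Omega.
    by apply: eclosed_ball_sub => //; lra.
  have := mv (divr_gt0 d0 (ltr0Sn _ _)) cB 0%R (lexx _).
  rewrite tr// (eq_integral (fun y : rVleb R n => (u y)%:E))//.
  by move=> y /set_mem By; apply: tr; exact: BO.
move=> mv; rewrite EFinM.
apply: le_trans (lee_wpmul2l _ mv) _; first by rewrite lee_fin powR_ge0.
rewrite muleA -EFinM.
have -> : (delta x `^ (n%:R + gamma) *
      (K / (ball_vol R n * (delta x / 4) ^+ n)) =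
    K / ball_vol R n * 4 ^+ n * delta x `^ gamma)%R.
  rewrite powRD; last by rewrite (gt_eqF d0) implybT.
  rewrite powR_mulrn ?(ltW d0)// expr_div_n invfM invf_div.
  have dn : (delta x ^+ n != 0)%R by rewrite expf_neq0 ?(gt_eqF d0).
  rewrite (_ : (_ * _ * (K * _) =
     K * (ball_vol R n)^-1 * 4 ^+ n * delta x `^ gamma *
     (delta x ^+ n * (delta x ^+ n)^-1))%R); last by ring.
  by rewrite divff// mulr1.
rewrite /mean_value_constant EFinM [in leRHS]EFinM -!muleA.
apply: lee_wpmul2l.
  by rewrite lee_fin !mulr_ge0 ?invr_ge0 ?ball_vol_ge0 ?exprn_ge0.
have mu' : measurable_fun (B : set (rVleb R n)) (fun y => (u y)%:E).
  by apply: measurable_funS mu => //; exact: measurable_open.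
have mw : measurable_fun (B : set (rVleb R n)) (weighted : rVleb R n -> \bar R).
  by apply: measurable_funS measurable_weighted => //; exact: measurable_open.
rewrite -ge0_integralZl_EFin ?powR_ge0//; last by move=> y /BO /u0.
rewrite -ge0_integralZl_EFin ?powR_ge0//; last by move=> y /BO /weighted_ge0.
apply: ge0_le_integral.
- exact: mB.
- by move=> y /BO Oy; rewrite mule_ge0 ?lee_fin ?powR_ge0 ?u0.
- exact: (measurable_funeM _ mu').
- exact: (measurable_funeM _ mw).
- move=> y By; have Oy := BO _ By; have dy := bdist_gt0 oO bO Oy.
  have /andP[h1 h2] := bdist_ball bO By.
  rewrite -!EFinM lee_fin mulrA ler_wpM2r ?u0// powR_comparable//; lra.
Qed.

(** The ball meets at most [3 * 3 ^ n] pieces, and one of them carries a fixed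
    fraction of the integral. *)
Lemma weighted_le_piece x : Omega x -> exists2 j,
  piece Omega j `&` eball x (delta x / 4) !=set0 &
  (delta x `^ (n%:R + gamma) * u x)%:E <=
    (mean_value_constant * #|{: 'I_3 * {ffun 'I_n -> 'I_3}}|%:R)%:E *
    \int[leb R n]_(y in piece Omega j) weighted y.
Proof.
move=> Ox; set B := eball x (delta x / 4).
have d0 := bdist_gt0 oO bO Ox.
have BO : B `<=` Omega by exact: ball_subset_domain.
have mO : measurable (Omega : set (rVleb R n)) by exact: measurable_open.
have mB : measurable (B : set (rVleb R n)) by exact/measurable_open/open_eball.
have mw : measurable_fun (B : set (rVleb R n)) (weighted : rVleb R n -> \bar R).
  exact: measurable_funS measurable_weighted.
have [s le_s] := @integral_cover_pigeonhole _ (rVleb R n) R (leb R n)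
  ('I_3 * {ffun 'I_n -> 'I_3})%type (ord0, [ffun=> ord0])
  (fun s => piece Omega (neighbor Omega x s)) B weighted mB
  (fun s => measurable_piece oO bO _) mw (fun y By => weighted_ge0 (BO _ By))
  (ball_sub_pieces oO bO Ox).
have c0 : 0 <= (mean_value_constant)%:E.
  by rewrite lee_fin mean_value_constant_ge0.
have cN0 : 0 <= (mean_value_constant * #|{: 'I_3 * {ffun 'I_n -> 'I_3}}|%:R)%:E.
  by rewrite EFinM mule_ge0.
have le0 := le_trans (weighted_mean_value Ox) (lee_wpmul2l c0 le_s).
rewrite muleA -EFinM in le0.
have [pB|pB] := eqVneq (piece Omega (neighbor Omega x s) `&` B) set0.
  (* the integral over this piece vanishes, so any piece that meets the ball
     will do: take the one containing x *)
  exists (cell Omega x).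
    exists x; split; first by split.
    rewrite /B /eball /= subrr /enorm big1 ?sqrtr0 ?divr_gt0// => i _.
    by rewrite mxE expr0n.
  apply: (le_trans le0); rewrite setIC pB integral_set0 mule0 mule_ge0//.
  by apply: integral_ge0 => y [Oy _]; exact: weighted_ge0.
exists (neighbor Omega x s); first exact/set0P.
apply: (le_trans le0); apply: lee_wpmul2l => //.
apply: ge0_subset_integral => //.
- exact: measurableI (measurable_piece oO bO _).
- exact: measurable_piece.
- by apply: measurable_funS measurable_weighted => // y [].
- by move=> y [Oy _]; exact: weighted_ge0.
Qed.

End mean_value.

(** * The boundary points whose approach regions see a given piece *)

Section contact_sets.
Context {R : realType} {n : nat} (Omega : set 'rV[R]_n).
Hypotheses (oO : open Omega) (bO : boundary Omega !=set0).
Variables (d : R) (phi : R -> R) (C0 r0 alpha : R).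
Hypotheses (d0 : 0 <= d) (adm : admissible phi C0 r0) (alpha0 : 0 < alpha).
Hypothesis reg : ahlfors_regular d (boundary Omega).
Hypothesis fin : (hausdorff_outer d (boundary Omega) < +oo)%E.
Local Notation delta := (bdist Omega).
Local Notation psi := (inv_phi phi).

(** The approach region of [zeta] counts as seeing a piece as soon as it
    contains a point whose mean value ball meets that piece. *)
Definition contact j : set 'rV[R]_n :=
  [set zeta | boundary Omega zeta /\ exists2 x,
    approach_region Omega phi zeta alpha x &
    piece Omega j `&` eball x (delta x / 4) !=set0].

(** The distance to the boundary at [x] may fall short of that in the piece by a
    factor [4 / 5]; going down one level absorbs it, and makes [scale (j.1 - 1)]
    a scale of the piece below all the distances that matter. *)
Lemma scale_le_bdist j x : Omega x ->
  piece Omega j `&` eball x (delta x / 4) !=set0 ->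
  scale (j.1 - 1) <= delta x <= 2 * scale (j.1 + 1).
Proof.
case: j => k q Ox [y [[Oy [/eqP lk _]] xy]]; have d0x := bdist_gt0 oO bO Ox.
have /andP[h1 h2] := bdist_ball bO xy.
move: lk; rewrite level_eq// => /andP[k1 k2] /=.
have s0 := @scale_gt0 R (k - 1).
have E1 : scale k = scale (k - 1) * scale 1 :> R by rewrite -scaleD subrK.
have e2 : 1 + 1 <= scale 1 :> R by exact: expR_ge1Dx.
have : scale (k - 1) * 2 <= scale k :> R by rewrite E1 ler_pM2l.
move=> h3; apply/andP; split; lra.
Qed.

(** A point [x] of the approach region of [zeta] has
    [enorm (x - zeta) < psi (alpha * delta x)], and [delta x] is itself at most
    [enorm (x - zeta)]; so the ball around [x] and the piece both have diameter
    bounded by a multiple of [psi] at the scale of the piece, and all contact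
    points lie in one ball of that size. *)
Lemma contact_diam m j zeta zeta' : 2 * scale 2 * alpha <= 2 ^+ m ->
  contact j zeta -> contact j zeta' ->
  enorm (zeta - zeta') < (4 + n%:R * scale 2) * psi (2 ^+ m * scale (j.1 - 1)).
Proof.
set t := scale (j.1 - 1) => hm.
have t0 : 0 < t by exact: scale_gt0.
have s2 : scale (j.1 + 1) = scale 2 * t by rewrite /t -scaleD; congr scale; lia.
set L := psi (2 ^+ m * t).
have key z : contact j z -> exists2 y, piece Omega j y &
    enorm (z - y) < 2 * L /\ t < L.
  move=> [bz [x [Ox xz] pj]]; have /andP[h1 h2] := scale_le_bdist Ox pj.
  case: pj => y [py xy]; exists y => //.
  have xzL : enorm (x - z) < L.
    rewrite (lt_inv_phi adm) ?enorm_ge0 ?mulr_ge0 ?exprn_ge0 ?(ltW t0)//.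
    apply: (lt_le_trans xz).
    apply: (@le_trans _ _ (alpha * (2 * scale (j.1 + 1)))).
      by rewrite ler_pM2l.
    rewrite s2 (_ : alpha * _ = 2 * scale 2 * alpha * t); last by ring.
    by rewrite ler_wpM2r// ltW.
  have dxz := bdist_le x bz.
  have := ler_enorm_trans x z y; rewrite (enormC z x) (enormC x y) => tri.
  move: xy; rewrite /eball/= => xy.
  have := bdist_gt0 oO bO Ox; rewrite -/t in h1; split; lra.
move=> /key[y py [zy tL]] /key[y' py' [zy' _]].
have := piece_diam py py'; rewrite s2 mulrA => yy'.
have := ler_enorm_trans y zeta zeta'; have := ler_enorm_trans y' y zeta'.
rewrite (enormC y' zeta') => tr1 tr2.
have : n%:R * scale 2 * t <= n%:R * scale 2 * L.
  by rewrite ler_wpM2l ?(ltW tL)// mulr_ge0// ltW// scale_gt0.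
move=> h; rewrite mulrDl; lra.
Qed.

(** At small scales, Ahlfors regularity bounds the measure by a power of the
    diameter, and the doubling of [psi] absorbs the factor [2 ^+ m]. Doubling is
    only available below [r0]; above the scale [rho] the finite measure of the
    whole boundary is itself at most a constant times [psi rho `^ d]. *)
Lemma hausdorff_contact : exists2 C2 : R, 0 <= C2 & forall j,
  (hausdorff_outer d (contact j) <= (C2 * psi (scale (j.1 - 1)) `^ d)%:E)%E.
Proof.
case: (reg) => _ [C4 [C40 up _]].
case: (adm) => [[C01 r00] _ _ _ _].
pose A := 2 * scale 2 * alpha.
pose m := Num.bound A.
have hm : A <= 2 ^+ m.
  have A0 : 0 <= A by rewrite !mulr_ge0 ?ltW// scale_gt0.
  apply: le_trans (ltW (archi_boundP A0)) _.
  by rewrite -natrX ler_nat ltnW// ltn_expl.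
have pm : 0 < 2 ^+ m :> R by rewrite exprn_gt0.
pose M := 4 + n%:R * scale 2 : R.
have M0 : 0 <= M by rewrite addr_ge0// mulr_ge0// ltW// scale_gt0.
pose rho := r0 / 2 ^+ m.
have rho0 : 0 < rho by rewrite divr_gt0.
pose h := fine (hausdorff_outer d (boundary Omega)).
have h0 : 0 <= h by rewrite fine_ge0// outer_measure_ge0.
have prho := powR_gt0 d (inv_phi_gt0 adm rho0).
pose Ca := C4 * (M * C0 ^+ m) `^ d.
have Ca0 : 0 <= Ca by rewrite mulr_ge0 ?powR_ge0// ltW.
pose Cb := h / psi rho `^ d.
have Cb0 : 0 <= Cb by rewrite divr_ge0// ltW.
exists (Ca + Cb) => [|j]; first exact: addr_ge0.
set t := scale (j.1 - 1).
have t0 : 0 < t by exact: scale_gt0.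
have pt := inv_phi_gt0 adm t0.
have [ct0|/set0P[z0 cz0]] := eqVneq (contact j) set0.
  by rewrite ct0 outer_measure0 lee_fin mulr_ge0 ?powR_ge0// addr_ge0.
have [tr|rt] := leP (2 ^+ m * t) r0.
  set r := M * psi (2 ^+ m * t).
  have r_gt0 : 0 < r.
    apply: le_lt_trans (contact_diam hm cz0 cz0); exact: enorm_ge0.
  apply: (@le_trans _ _ (hausdorff_outer d (boundary Omega `&` eball z0 r))).
    apply: le_outer_measure => z cz; split; first by case: cz.
    exact: contact_diam hm cz cz0.
  apply: (le_trans (up z0 r (proj1 cz0) r_gt0)); rewrite lee_fin.
  rewrite mulrDl; apply: (@le_trans _ _ (Ca * psi t `^ d)); last first.
    by rewrite lerDl mulr_ge0 ?powR_ge0.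
  rewrite /Ca -mulrA ler_pM2l//.
  rewrite -powRM ?mulr_ge0 ?exprn_ge0 ?(ltW pt)//; last lra.
  rewrite ge0_ler_powR ?nnegrE ?(ltW r_gt0)//.
    by rewrite !mulr_ge0 ?exprn_ge0 ?(ltW pt)//; lra.
  by rewrite /r -mulrA ler_wpM2l// (inv_phi_doubling adm)// ltW.
apply: (@le_trans _ _ (hausdorff_outer d (boundary Omega))).
  by apply: le_outer_measure => z [].
have -> : hausdorff_outer d (boundary Omega) = h%:E.
  by rewrite fineK// ge0_fin_numE// outer_measure_ge0.
rewrite lee_fin mulrDl; apply: (@le_trans _ _ (Cb * psi t `^ d)); last first.
  by rewrite lerDr mulr_ge0 ?powR_ge0.
rewrite /Cb -mulrA ler_peMr// ler_pdivlMl// mulr1.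
rewrite ge0_ler_powR ?nnegrE ?(inv_phi_ge0 adm) ?(ltW rho0) ?(ltW t0)//.
apply: (le_inv_phi adm); first exact: ltW.
by rewrite /rho ler_pdivrMr// mulrC ltW.
Qed.

End contact_sets.

(** * The maximal inequality *)

Lemma countable_enumeration (I : countType) : exists e : nat -> option I,
  (forall i, exists k, e k = Some i) /\
  (forall k l i, e k = Some i -> e l = Some i -> k = l).
Proof.
exists (@pickle_inv I); split=> [i|k l i ek el].
  by exists (pickle i); rewrite pickleK_inv.
have := @pickle_invK I k; have := @pickle_invK I l.
by rewrite ek el /= => -> ->.
Qed.

Theorem theorem2 (R : realType) (n : nat) (hn : (2 <= n)%N)
  (d : R) (hd : 0 <= d <= n%:R)
  (Omega : set 'rV[R]_n) (hOmega : is_domain Omega) (hOmegaT : Omega <> setT)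
  (hreg : ahlfors_regular d (boundary Omega))
  (hfin : (hausdorff_outer d (boundary Omega) < +oo)%E)
  (K : R) (hK : 1 <= K)
  (phi : R -> R) (C0 r0 : R) (hphi : admissible phi C0 r0)
  (alpha : R) (halpha : 0 < alpha) (gamma : R) :
  exists C : R, 0 < C /\
    forall u : 'rV[R]_n -> R,
      (forall x, Omega x -> 0 <= u x) ->
      quasi_nearly_subharmonic K Omega (fun x => (u x)%:E) ->
      (\int[leb R n]_(x in Omega) (bdist Omega x `^ gamma * u x)%:E < +oo)%E ->
      (\int[hausdorff n d]_(zeta in boundary Omega)
         nnsup [set (bdist Omega x `^ (n%:R + gamma)
                     * inv_phi phi (bdist Omega x) `^ (- d) * u x)%:E
               | x in approach_region Omega phi zeta alpha]
       <= C%:E *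
         \int[leb R n]_(x in Omega) (bdist Omega x `^ gamma * u x)%:E)%E.
Proof.
have [[x0 Ox0] oO _] := hOmega; have /andP[d0 _] := hd.
have bO : boundary Omega !=set0.
  have [y nOy] : exists y, ~ Omega y.
    apply: contrapT => /forallNP h; apply: hOmegaT.
    by apply/seteqP; split => // y _; exact: contrapT (h y).
  by have [z bz _] := segment_meets_boundary oO Ox0 nOy; exists z.
have K0 : 0 <= K by lra.
have [C2 C20 hC2] := hausdorff_contact oO bO d0 hphi halpha hreg hfin.
pose C1 := mean_value_constant (n := n) K gamma *
  #|{: 'I_3 * {ffun 'I_n -> 'I_3}}|%:R.
have C10 : 0 <= C1 by rewrite mulr_ge0// mean_value_constant_ge0.
exists (C1 * C2 + 1); split; first by rewrite ltr_wpDl// mulr_ge0.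
have [e [e_onto e_inj]] := countable_enumeration
  (int * {ffun 'I_n -> int})%type.
move=> u u0 qu _.
set J := (\int[leb R n]_(x in Omega) _)%E.
pose w := weighted Omega gamma u.
pose P k : set (rVleb R n) := oapp (piece Omega) set0 (e k).
pose E k := oapp (contact Omega phi alpha) set0 (e k).
pose t (j : int * {ffun 'I_n -> int}) : R := scale (j.1 - 1).
have psi_gt0 j : 0 < inv_phi phi (t j).
  by apply: (inv_phi_gt0 hphi); exact: scale_gt0.
pose a k := oapp (fun j => (C1 * inv_phi phi (t j) `^ (- d))%:E *
  \int[leb R n]_(y in piece Omega j) w y)%E 0%E (e k).
have w0 j y : piece Omega j y -> (0 <= w y)%E.
  by move=> [Oy _]; exact: weighted_ge0.
have c0 j : 0 <= C1 * inv_phi phi (t j) `^ (- d) by rewrite mulr_ge0 ?powR_ge0.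
have a0 k : (0 <= a k)%E.
  rewrite /a; case: (e k) => //= j; rewrite mule_ge0 ?lee_fin//.
  by apply: integral_ge0 => y; exact: w0.
apply: (@le_trans _ _ (\sum_(k <oo) a k * hausdorff_outer d (E k))%E).
  apply: integral_le_weighted_cover => //.
    by move=> z _; apply: ereal_sup_ubound; left.
  move=> z v bz v0 /ereal_sup_gt[_ [->|[x [Ox xz] <-]]].
    by rewrite lte_fin ltNge (ltW v0).
  rewrite lte_fin => vx.
  (* by the monotonicity of the inverse, the weight at x is at most the weight
     at the lower scale t j of the piece *)
  have [j pj wj] := weighted_le_piece oO bO gamma K0 u0 qu Ox.
  have [k ek] := e_onto j.
  exists k; first by rewrite /E ek; split => //; exists x.
  rewrite /a ek /=; apply: (@le_trans _ _ ((inv_phi phi (t j) `^ (- d))%:E *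
      (bdist Omega x `^ (n%:R + gamma) * u x)%:E)%E); last first.
    rewrite [X in (_ <= X%:E * _)%E]mulrC [in leRHS]EFinM -muleA.
    apply: lee_wpmul2l wj.
    by rewrite lee_fin powR_ge0.
  rewrite -EFinM lee_fin (le_trans (ltW vx))// mulrAC mulrC.
  rewrite ler_wpM2r ?mulr_ge0 ?powR_ge0 ?u0// !powRN.
  have /andP[tx _] := scale_le_bdist oO bO Ox pj.
  have dx0 := bdist_gt0 oO bO Ox.
  have pp := psi_gt0 j; have px := inv_phi_gt0 hphi dx0.
  rewrite lef_pV2 ?posrE ?powR_gt0//.
  apply: ge0_ler_powR => //; rewrite ?nnegrE ?(ltW pp) ?(ltW px)//.
  by apply: (le_inv_phi hphi) tx; rewrite ltW// scale_gt0.
have JE : (J = \sum_(k <oo) \int[leb R n]_(y in P k) w y)%E.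
  have PO : Omega = \bigcup_k P k.
    apply/seteqP; split => y.
      have [k ek] := e_onto (cell Omega y).
      by move=> Oy; exists k => //; rewrite /P ek.
    by move=> [k _]; rewrite /P; case: (e k) => //= j [].
  transitivity (\int[leb R n]_(y in \bigcup_k P k) w y)%E; first by rewrite -PO.
  apply: ge0_integral_bigcup.
  - move=> k; rewrite /P; case: (e k) => [j|] /=; first exact: measurable_piece.
    exact: measurable0.
  - by rewrite -PO; exact: (measurable_weighted bO gamma qu).
  - by move=> y; rewrite -PO; exact: weighted_ge0.
  - move=> k l _ _ [y []]; rewrite /P.
    case ek : (e k) => [j|]//= [_ jy].
    case el : (e l) => [i|]//= [_ iy].
    by apply: (e_inj k l j ek); rewrite el -iy jy.
have J0 : (0 <= J)%E by apply: integral_ge0 => y; exact: weighted_ge0.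
apply: (@le_trans _ _ ((C1 * C2)%:E * J)%E); last first.
  by apply: lee_wpmul2r => //; rewrite lee_fin lerDl.
rewrite JE -nneseriesZl; last first.
  move=> k _; apply: integral_ge0 => y; rewrite /P; case: (e k) => //= j.
  exact: w0.
apply: lee_nneseries => [k _ _|k _].
  by rewrite mule_ge0 ?outer_measure_ge0.
rewrite /a /E /P; case: (e k) => [j|] /=; last first.
  by rewrite mul0e integral_set0 mule0.
rewrite -muleA [X in (_ * X)%E]muleC muleA; apply: lee_wpmul2r.
  by apply: integral_ge0 => y; exact: w0.
apply: le_trans (lee_wpmul2l _ (hC2 j)) _; first by rewrite lee_fin.
rewrite -EFinM lee_fin -/(t j) powRN.
have pd : inv_phi phi (t j) `^ d != 0 by rewrite lt0r_neq0// powR_gt0.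
by rewrite mulrACA mulVf// mulr1.
Qed.
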